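(* Let $h\in\mathbb N$ be fixed, let $G_n^h=(V,E)$ be the preferential attachment graph, and let $M=hn$. Then for every $\varepsilon>0$, with high probability as $n\to\infty$, $$\forall S\subseteq V:\quad \left|e(S,V\setminus S)-2\mu(\tilde S)\left(\sqrt M-\mu(\tilde S)\right)\right|\le(1+\varepsilon)\left(\frac32\,g_{\mathcal V}(h)+\sqrt{2\ln2}\right)\frac{M}{\sqrt h},$$ where $g_{\mathcal V}(h)=\frac16\sqrt{2\ln2\,(9\ln h+8\ln2)}+\frac23\ln2+2$.
   Context: $\mathbb N=\{1,2,\dots\}$, $[n]=\{1,\dots,n\}$. With high probability (as $n\to\infty$) means with probability tending to $1$ as $n\to\infty$, with $h$ and $\varepsilon$ fixed. Graphs are finite, undirected, and may have loops and multiple edges; in degrees $\deg(v)$ loops are counted twice; $e(S,U)$ is the number of edges (with multiplicity) meeting both $S$ and $U$ (here in $G_n^h$). Preferential attachment graph $G_n^h$: Phase 1. $T_1$ is the graph with the single (mini-)vertex $1$ and a single loop at it (so its degree is $2$). For $t\ge1$, given $T_t$, the graph $T_{t+1}$ is obtained by adding the mini-vertex $t+1$ and one edge joining it to a random mini-vertex $i$, where, conditionally on the history, $\Pr(i=s)=\frac{\deg_{T_t}(s)}{2t+1}$ for $1\le s\le t$ and $\Pr(i=t+1)=\frac1{2t+1}$ (a loop). Continue until $T_{hn}$, with vertex set $\tilde V=[hn]$, is obtained. Phase 2. $G_n^h$ is obtained from $T_{hn}$ by merging, for each $i\in[n]$, the mini-vertices $h(i-1)+1,\dots,h(i-1)+h$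 into a single vertex $i$, keeping loops and multiple edges. So $V=[n]$ and $|E|=hn=M$. For $S\subseteq V$, $\tilde S\subseteq[M]$ is the set of corresponding mini-vertices, $\tilde S=\bigcup_{i\in S}\{h(i-1)+1,\dots,hi\}$. For $A\subseteq[M]$ define $\mu(A)=\frac{\sqrt\pi}{2}\sum_{j\in A}c_{j-1}$, where $c_0=1$ and $c_j=\prod_{i=1}^j\frac{2i-1}{2i}$ for $j\ge1$. *)

(* Defs.v *)
From HB Require Import structures.
From mathcomp Require Import all_boot all_order all_algebra.
From mathcomp Require Import all_classical all_reals all_analysis.
Set Implicit Arguments.
Unset Strict Implicit.
Unset Printing Implicit Defensive.
Import Order.TTheory GRing.Theory Num.Theory.
Import numFieldNormedType.Exports.

Local Open Scope ring_scope.

(* The list of the edges with their multiplicities; each edge is undirected,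
   given by its two endpoints in an arbitrary order. *)
Definition multigraph (V : finType) := seq (V * V).

Definition deg (V : finType) (G : multigraph V) (v : V) : nat :=
  (\sum_(e <- G) ((e.1 == v) + (e.2 == v)))%N.

Definition meets (V : finType) (e : V * V) (S : {set V}) : bool :=
  (e.1 \in S) || (e.2 \in S).

Definition edges_between (V : finType) (G : multigraph V) (S U : {set V}) : nat :=
  count (fun e => meets e S && meets e U) G.

Definition merge_graph (V W : finType) (f : V -> W) (G : multigraph V) :
  multigraph W := [seq (f e.1, f e.2) | e <- G].

(* Mini-vertices and vertices are numbered from 0: the ordinal k stands for the
   (mini-)vertex k + 1.  An outcome of the attachment process on M
   mini-vertices records the mini-vertex w k to which each new k attaches. *)
Definition choices (M : nat) := {ffun 'I_M -> 'I_M}.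

(* The graph T_t, on the mini-vertices k < t. *)
Definition pa_tree (M : nat) (w : choices M) (t : nat) : multigraph 'I_M :=
  [seq (k, w k) | k : 'I_M <- enum 'I_M & (k < t)%N].

(* Given G = T_t, the probability that the new mini-vertex (the ordinal t)
   attaches to s.  For t = 0 this is a loop with probability 1, so that T_1 is
   the single loop. *)
Definition attach_prob (R : realType) (M : nat) (G : multigraph 'I_M)
    (t s : 'I_M) : R :=
  if (s < t)%N then (deg G s)%:R / (2 * t + 1)%:R
  else if s == t then 1 / (2 * t + 1)%:R
  else 0.

(* The law of the process, by the chain rule. *)
Definition pa_weight (R : realType) (M : nat) (w : choices M) : R :=
  \prod_(t < M) attach_prob R (pa_tree w t) t (w t).

Definition pa_prob (R : realType) (M : nat) (E : pred (choices M)) : R :=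
  \sum_(w : choices M | E w) pa_weight R w.

Lemma merge_subproof (h n : nat) (k : 'I_(h * n)) : (k %/ h < n)%N.
Proof.
case: h k => [|h] k; first by case: k.
by rewrite ltn_divLR // [(n * _)%N]mulnC.
Qed.

Definition merge (h n : nat) (k : 'I_(h * n)) : 'I_n :=
  Ordinal (merge_subproof k).

Definition pa_graph (h n : nat) (w : choices (h * n)) : multigraph 'I_n :=
  merge_graph (@merge h n) (pa_tree w (h * n)).

Definition mini (h n : nat) (S : {set 'I_n}) : {set 'I_(h * n)} :=
  [set k | merge k \in S]%SET.

Definition coef (R : realType) (j : nat) : R :=
  \prod_(1 <= i < j.+1) ((2 * i%:R - 1) / (2 * i%:R)).

(* The ordinal j is the mini-vertex j + 1, hence coef j and not coef j.-1. *)
Definition mu (R : realType) (M : nat) (A : {set 'I_M}) : R :=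
  Num.sqrt pi / 2 * \sum_(j in A) coef R j.

Definition gV (R : realType) (h : nat) : R :=
  1 / 6 * Num.sqrt (2 * ln 2 * (9 * ln h%:R + 8 * ln 2)) + 2 / 3 * ln 2 + 2.

(* pa_weight is a probability distribution on the outcomes. *)
Lemma attach_prob_ge0 (R : realType) (M : nat) (G : multigraph 'I_M)
    (t s : 'I_M) : 0 <= attach_prob R G t s.
Proof. by rewrite /attach_prob; do 2?case: ifP => // _; rewrite divr_ge0. Qed.

Lemma pa_weight_ge0 (R : realType) (M : nat) (w : choices M) :
  0 <= pa_weight R w.
Proof. by apply: prodr_ge0 => t _; exact: attach_prob_ge0. Qed.

Lemma card_ltn_ord (M t : nat) : (t <= M)%N -> (\sum_(k < M | (k < t)%N) 1 = t)%N.
Proof.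
by move=> tM; rewrite -(big_ord_widen M (fun=> 1%N)) // sum1_card card_ord.
Qed.

Lemma degE (M : nat) (w : choices M) (t : nat) (s : 'I_M) :
  deg (pa_tree w t) s = (\sum_(k < M | (k < t)%N) ((k == s) + (w k == s)))%N.
Proof. by rewrite /deg /pa_tree big_map big_filter big_enum_cond. Qed.

Lemma sum_deg (M : nat) (w : choices M) (t : nat) :
  (t <= M)%N -> (forall k, (w k <= k)%N) ->
  (\sum_(s < M | (s < t)%N) deg (pa_tree w t) s = 2 * t)%N.
Proof.
move=> tM wle; under eq_bigr do rewrite degE.
rewrite exchange_big /= -[in RHS](card_ltn_ord tM) big_distrr /=.
apply: eq_bigr => k kt; have wt := leq_ltn_trans (wle k) kt.
rewrite big_split /=.
rewrite (bigD1 k) //= eqxx big1 ?addn0; last first.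
  by move=> i /andP[_ /negPf ik]; rewrite eq_sym ik.
rewrite (bigD1 (w k)) //= eqxx big1 ?addn0 //.
by move=> i /andP[_ /negPf ik]; rewrite eq_sym ik.
Qed.

Lemma sum_attach_prob (R : realType) (M : nat) (w : choices M) (t : 'I_M) :
  (forall k, (w k <= k)%N) ->
  \sum_(s < M | (s <= t)%N) attach_prob R (pa_tree w t) t s = 1.
Proof.
move=> wle; rewrite (bigD1 t) //= {1}/attach_prob ltnn eqxx.
rewrite (eq_big (fun s : 'I_M => (s < t)%N)
  (fun s => (deg (pa_tree w t) s)%:R / (2 * t + 1)%:R)); first last.
- move=> s /andP[st nst]; rewrite /attach_prob ltn_neqAle st andbT.
  by rewrite (inj_eq val_inj) nst.
- by move=> s; rewrite ltn_neqAle andbC (inj_eq val_inj).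
rewrite -mulr_suml -natr_sum sum_deg // ?(ltnW (ltn_ord t)) //.
by rewrite -mulrDl addrC natr1 -addn1 divff // pnatr_eq0 addn1.
Qed.

Lemma pa_prob_total (R : realType) (M : nat) : pa_prob R (@predT (choices M)) = 1.
Proof.
pose val_ (w : choices M) := [forall i, (w i <= i)%N].
pose fix_ k (w : choices M) := [forall i : 'I_M, (k <= i)%N ==> (w i == i)].
pose upd (o s : 'I_M) (w : choices M) : choices M :=
  [ffun i => if i == o then s else w i].
have treeE (o s : 'I_M) w (t : nat) : (t <= o)%N -> pa_tree (upd o s w) t = pa_tree w t.
  move=> to; rewrite /pa_tree; apply/eq_in_map => k; rewrite mem_filter ffunE.
  by case: eqP => // -> /andP[]; rewrite ltnNge to.
have main k : (k <= M)%N -> \sum_(w | val_ w && fix_ k w)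
    \prod_(t < M | (t < k)%N) attach_prob R (pa_tree w t) t (w t) = 1.
  elim: k => [_|k IH kM].
    rewrite (big_pred1 [ffun i => i]) => [|w]; first by rewrite big_pred0.
    apply/andP/eqP => [[_ /forallP wi]|->].
      by apply/ffunP => i; rewrite ffunE; exact/eqP/wi.
    by split; apply/forallP => i; rewrite ffunE ?leqnn ?eqxx.
  pose o := Ordinal kM; rewrite -[RHS](IH (ltnW kM)).
  rewrite (partition_big (upd o o) (fun w => val_ w && fix_ k w)) /=; last first.
    move=> w /andP[/forallP wv /forallP wf]; apply/andP; split; apply/forallP=> i.
      by rewrite ffunE; case: (i =P o) => [->|].
    rewrite ffunE; case: (i =P o) => [->|/eqP io]; first by rewrite eqxx implybT.
    apply/implyP => ki; apply: (implyP (wf i)); rewrite ltn_neqAle ki andbT.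
    by apply: contraNneq io => ok; apply/eqP/val_inj.
  apply: eq_bigr => w /andP[/forallP wv /forallP wf].
  have wo : w o = o by apply/eqP/(implyP (wf o)).
  rewrite (reindex_onto (fun s => upd o s w) (fun w' => w' o)) /=; last first.
    move=> w' /andP[_ /eqP <-]; apply/ffunP => i; rewrite !ffunE.
    by case: (i =P o) => [->|].
  rewrite (eq_bigl (fun s : 'I_M => (s <= o)%N)) => [|s]; last first.
    apply/idP/idP => [/andP[/andP[/andP[/forallP /(_ o)]]]|so].
      by rewrite ffunE eqxx.
    rewrite ffunE !eqxx andbT; apply/andP; split; last first.
      by apply/eqP/ffunP => i; rewrite !ffunE; case: (i =P o) => [->|].
    apply/andP; split; apply/forallP => i; rewrite ffunE.
      by case: (i =P o) => [->|].
    apply/implyP => ki; rewrite ifN_eq; last by rewrite -(inj_eq val_inj) gtn_eqF.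
    by apply: (implyP (wf i)); exact: ltnW.
  rewrite -[RHS]mul1r -(sum_attach_prob R o wv) mulr_suml.
  apply: eq_bigr => s so; rewrite (bigD1 o) //= treeE // ffunE eqxx.
  congr (_ * _); apply: eq_big => [i|i /andP[ik io]].
    by rewrite ltnS [RHS]ltn_neqAle andbC -(inj_eq val_inj).
  by rewrite treeE ?ffunE ?(negPf io).
rewrite -[RHS](main M (leqnn M)) /pa_prob (bigID val_) /= [X in _ + X]big1.
  rewrite addr0; apply: eq_big => [w|w _].
    rewrite /fix_; case: (val_ w) => //=; symmetry; apply/forallP => i.
    by rewrite leqNgt ltn_ord.
  by rewrite /pa_weight; apply: eq_bigl => i; rewrite ltn_ord.
move=> w /forallPn [i]; rewrite -ltnNge => iw.
rewrite /pa_weight (bigD1 i) //= /attach_prob ltnNge (ltnW iw) /=.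
by rewrite -(inj_eq val_inj) gtn_eqF // mul0r.
Qed.

(* Main.v *)
Require Import Defs.
From HB Require Import structures.
From mathcomp Require Import all_boot all_order all_algebra.
From mathcomp Require Import all_classical all_reals all_analysis.
From mathcomp Require Import ring lra.
Set Implicit Arguments.
Unset Strict Implicit.
Unset Printing Implicit Defensive.
Import Order.TTheory GRing.Theory Num.Theory.
Import numFieldNormedType.Exports.
Local Open Scope classical_set_scope.
Local Open Scope ring_scope.

(* Fix S, let A be the set of its mini-vertices, a_t = [t in A],
   x_t = [w t in A], and let p_t be the probability of x_t = 1 given the
   past.  The cut is a_t + (1 - 2 a_t) x_t summed over t.  Since p_t is affine
   in the current volume of A, this sum equals a deterministic main term plus
   the sum of K_t (x_t - p_t) with deterministic gains K_t, and
   |K_t| <= c_(t+1) / c_M <= sqrt (M / (t+1)).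
   Wallis' product puts the main term within O(sqrt M) of
   2 mu (sqrt M - mu).  The first n = M / h steps contribute at most
   2 sqrt (n M) = 2 M / sqrt h.  For the others the squared gains add up to at
   most M ln h, so Hoeffding's bound beats the union over the 2 ^ n sets S.
   The factor 3 / 2 on gV leaves room for all the lower order terms. *)

(** * Hoeffding's lemma for a centred two-point variable *)

Lemma is_derive_ge0_le (R : realType) (f f' : R -> R) (a b : R) : a <= b ->
  (forall x, a <= x <= b -> is_derive x 1 f (f' x)) ->
  (forall x, a <= x <= b -> 0 <= f' x) -> f a <= f b.
Proof.
move=> ab df f'0.
have [||c] := @MVT_segment R f f' a b ab.
- by move=> x; rewrite in_itv /= => /andP[ax xb]; apply: df; rewrite !ltW.
- apply: derivable_within_continuous => x; rewrite in_itv /= => xab.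
  by have [] := df x xab.
rewrite in_itv /= => cab fE; rewrite -subr_ge0 fE mulr_ge0 ?subr_ge0 //.
exact: f'0.
Qed.

(** Divided by e^(s^2/8), the left side becomes Q(s) e^(-(p s + s^2/8)), which is 1 at 0 and does
    not increase for s >= 0, because [psi] is nonnegative there. *)
Lemma hoeffding_ge0 (R : realType) (p s : R) : 0 <= p <= 1 -> 0 <= s ->
  p * expR (s * (1 - p)) + (1 - p) * expR (s * (0 - p)) <= expR (s ^+ 2 / 8).
Proof.
move=> /andP[p0 p1] s0.
pose Q x : R := 1 - p + p * expR x.
have Q0 x : 0 < Q x.
  rewrite /Q; have := expR_gt0 x; have [->|p_neq0] := eqVneq p 0; first lra.
  move=> ex; have : 0 < p * expR x by rewrite pmulr_lgt0 // lt_def p_neq0.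
  lra.
have QE x : Q x != 0 by rewrite gt_eqF.
(* [psi] is the derivative of p x + x^2/8 - ln Q(x), using p e^x / Q = 1 - (1 - p) / Q. *)
pose psi x : R := 1 / 4 * x + (p - 1) + (1 - p) * (Q x)^-1.
have psi0 x : 0 <= x -> 0 <= psi x.
  move=> x0; have -> : 0 = psi 0 by rewrite /psi /Q expR0; field; lra.
  pose psi' y : R := 1 / 4 + (1 - p) * - ((Q y)^-2 * (p * expR y)).
  apply: (@is_derive_ge0_le R psi psi') => // y _.
    have := QE y; rewrite /psi /psi' /Q => Qy.
    apply: is_derive_eq. rewrite /GRing.scale /=.
    by field.
  (* With q = p e^y / Q(y) this reads 1/4 - q (1 - q) = (1 - 2 q)^2 / 4. *)
  have -> : psi' y = (1 - p - p * expR y) ^+ 2 / (4 * Q y ^+ 2).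
    by rewrite /psi' /Q; field; exact: QE.
  apply: divr_ge0; first exact: sqr_ge0.
  by apply: mulr_ge0; rewrite ?sqr_ge0.
pose G x : R := - (Q x * expR (- (p * x + x ^+ 2 / 8))).
have : G 0 <= G s.
  pose G' x : R := expR (- (p * x + x ^+ 2 / 8)) * (Q x * psi x).
  apply: (@is_derive_ge0_le R G G') => // y /andP[y0 _].
    have := QE y; rewrite /G /G' /psi /Q => Qy.
    apply: is_derive_eq; rewrite /GRing.scale /=. by field.
  apply: mulr_ge0; rewrite ?expR_ge0 //; apply: mulr_ge0; first exact/ltW.
  exact: psi0.
rewrite /G [Q 0]/Q expR0 expr0n /= !(mulr0, mul0r, addr0, oppr0) expR0 => GE.
have -> : p * expR (s * (1 - p)) + (1 - p) * expR (s * (0 - p)) =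
    Q s * expR (- (p * s + s ^+ 2 / 8)) * expR (s ^+ 2 / 8).
  rewrite -mulrA -expRD /Q [RHS]mulrDl -[in RHS]mulrA -[in RHS]expRD addrC.
  by congr (_ * expR _ + _ * expR _); ring.
by rewrite -[leRHS]mul1r ler_pM2r ?expR_gt0 //; lra.
Qed.

(** Negative s reduces to positive s by exchanging the two outcomes, that is, p and 1 - p. *)
Lemma hoeffding (R : realType) (p s : R) : 0 <= p <= 1 ->
  p * expR (s * (1 - p)) + (1 - p) * expR (s * (0 - p)) <= expR (s ^+ 2 / 8).
Proof.
move=> p01; have [s0|s0] := leP 0 s; first exact: hoeffding_ge0.
have q01 : 0 <= 1 - p <= 1 by lra.
have := hoeffding_ge0 q01 (_ : 0 <= - s); rewrite sqrrN.
have -> : - s * (1 - (1 - p)) = s * (0 - p) by ring.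
have -> : - s * (0 - (1 - p)) = s * (1 - p) by ring.
have -> : 1 - (1 - p) = p by ring.
by rewrite addrC; apply; lra.
Qed.

(** * Wallis integrals *)

(* [v] is the integral of [cos ^+ n] over [0, pi / 2]. *)
Definition wallis_value (R : realType) (n : nat) (v : R) :=
  exists F : R -> R, [/\ forall x : R, is_derive x 1 F (cos x ^+ n),
    F 0 = 0 & F (pi / 2) = v].

Lemma wallis_value0 (R : realType) : wallis_value 0 (pi / 2 : R).
Proof. by exists id; split=> // x; rewrite expr0; exact: is_derive_id. Qed.

Lemma wallis_value1 (R : realType) : wallis_value 1 (1 : R).
Proof.
exists sin; split; rewrite ?sin0 ?sin_pihalf // => x; rewrite expr1.
exact: is_derive_sin.
Qed.

Lemma wallis_valueSS (R : realType) (n : nat) (v : R) :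
  wallis_value n v -> wallis_value n.+2 (n.+1%:R / n.+2%:R * v).
Proof.
move=> [F [dF F0 Fpi]].
(* Integration by parts; the boundary term sin cos^(n+1) vanishes at 0 and at pi / 2. *)
exists (fun x => n.+2%:R^-1 * (sin x * cos x ^+ n.+1 + n.+1%:R * F x)).
split=> [x||].
- have key (k c : R) : is_derive x 1
      (fun x => k * (sin x * cos x ^+ n.+1 + c * F x))
      (k * (cos x * cos x ^+ n.+1 - sin x ^+ 2 * (n.+1%:R * cos x ^+ n)
            + c * cos x ^+ n)).
    have dFx := dF x.
    have dcos : is_derive x 1 (fun x => cos x ^+ n.+1 : R)
        (n.+1%:R * cos x ^+ n * - sin x).
      by have := is_deriveX n.+1 (is_derive_cos x); rewrite exprfctE.
    by apply: is_derive_eq; rewrite /GRing.scale /=; ring.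
  have := key n.+2%:R^-1 n.+1%:R; congr (is_derive _ _ _ _).
  rewrite sin2cos2 !exprS.
  have -> : (n.+2%:R : R) = n.+1%:R + 1 by rewrite natr1.
  have n0 : (n.+1%:R + 1 : R) != 0 by rewrite natr1 pnatr_eq0.
  field.
  by rewrite nat1r.
- by rewrite sin0 F0 mul0r mulr0 addr0 mulr0.
- by rewrite cos_pihalf Fpi expr0n /= mulr0 add0r mulrA; congr (_ * _); rewrite mulrC.
Qed.

Lemma wallis_value_mono (R : realType) (n : nat) (v w : R) :
  wallis_value n v -> wallis_value n.+1 w -> w <= v.
Proof.
move=> [F [dF F0 <-]] [G [dG G0 <-]]; rewrite -subr_ge0.
have -> : 0 = F 0 - G 0 by rewrite F0 G0 subrr.
have pi0 : 0 <= pi / 2 :> R by rewrite divr_ge0 ?pi_ge0.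
apply: (@is_derive_ge0_le R (F - G) (fun x => cos x ^+ n - cos x ^+ n.+1)) => //.
move=> x /andP[x0 xpi]; rewrite exprS.
have cx : 0 <= cos x by apply: cos_ge0_pihalf; rewrite xpi andbT; lra.
by rewrite -{1}[cos x ^+ n]mul1r -mulrBl mulr_ge0 ?exprn_ge0 // subr_ge0 cos_le1.
Qed.

(** * Size and sums of the coefficients c_t *)

Lemma coef_0 (R : realType) : coef R 0 = 1.
Proof. by rewrite /coef big_geq. Qed.

Lemma coef_succ (R : realType) (t : nat) :
  coef R t.+1 = coef R t * ((2 * t%:R + 1) / (2 * t%:R + 2)).
Proof.
rewrite /coef big_nat_recr //= -natr1.
by congr (_ * (_ / _)); ring.
Qed.

Lemma coef_gt0 (R : realType) (t : nat) : 0 < coef R t.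
Proof.
elim: t => [|t IH]; first by rewrite coef_0.
by rewrite coef_succ mulr_gt0 // divr_gt0 // ltr_pwDr // mulr_ge0.
Qed.

Lemma wallis_even (R : realType) (t : nat) :
  wallis_value t.*2 (pi / 2 * coef R t).
Proof.
elim: t => [|t IH]; first by rewrite coef_0 mulr1; exact: wallis_value0.
rewrite doubleS; have := wallis_valueSS IH; rewrite coef_succ.
have -> : (t.*2.+2%:R : R) = 2 * t%:R + 2 by rewrite -muln2; lra.
have -> : (t.*2.+1%:R : R) = 2 * t%:R + 1 by rewrite -muln2; lra.
by congr wallis_value; rewrite mulrC mulrA.
Qed.

Lemma wallis_odd (R : realType) (t : nat) :
  wallis_value t.*2.+1 (((2 * t%:R + 1) * coef R t)^-1).
Proof.
elim: t => [|t IH].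
  by rewrite coef_0 mulr0 add0r mulr1 invr1; exact: wallis_value1.
rewrite doubleS; have := wallis_valueSS IH; rewrite coef_succ.
have -> : (t.*2.+2%:R : R) = 2 * t%:R + 2 by rewrite -muln2; lra.
have -> : (t.*2.+3%:R : R) = 2 * t%:R + 3 by rewrite -muln2; lra.
congr wallis_value; have ct := gt_eqF (coef_gt0 R t).
have t0 : 0 <= t%:R :> R by [].
rewrite -natr1; field; rewrite ct /=.
by apply/and3P; split; apply/negP => /eqP; lra.
Qed.

(** Wallis integrals decrease: comparing indices 2t + 1 and 2t gives this bound, comparing 2t + 2
    and 2t + 1 gives [coef_sqr_ub]. Together they make c_t asymptotic to 1 / sqrt (pi t). *)
Lemma coef_sqr_lb (R : realType) (t : nat) :
  1 <= pi * (t%:R + 2^-1) * coef R t ^+ 2.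
Proof.
have t0 : 0 <= t%:R :> R by [].
have := wallis_value_mono (wallis_even R t) (wallis_odd R t).
have c0 := coef_gt0 R t.
rewrite -div1r ler_pdivrMr ?mulr_gt0 // ?ltr_pwDr ?mulr_ge0 //; lra.
Qed.

Lemma coef_sqr_ub (R : realType) (t : nat) : pi * t%:R * coef R t ^+ 2 <= 1.
Proof.
case: t => [|t]; first by rewrite mulr0 mul0r.
have t0 : 0 <= t%:R :> R by [].
have := wallis_value_mono (wallis_odd R t) (wallis_even R t.+1).
have c0 := coef_gt0 R t; have c1 := coef_gt0 R t.+1.
rewrite -(div1r (_ * _)) ler_pdivlMr ?mulr_gt0 // ?ltr_pwDr ?mulr_ge0 //.
have : (2 * t%:R + 1) * coef R t = (2 * t%:R + 2) * coef R t.+1.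
  by rewrite coef_succ; field; lra.
by move=> ->; rewrite -[t.+1%:R]natr1; lra.
Qed.

Lemma coef_ge0 (R : realType) (t : nat) : 0 <= coef R t.
Proof. exact/ltW/coef_gt0. Qed.

Lemma coefS_eq (R : realType) (t : nat) :
  (2 * t%:R + 2) * coef R t.+1 = (2 * t%:R + 1) * coef R t.
Proof.
have t0 : 0 <= t%:R :> R by [].
by rewrite coef_succ; field; lra.
Qed.

Lemma coef_le1 (R : realType) (t : nat) : coef R t <= 1.
Proof.
elim: t => [|t IH]; first by rewrite coef_0.
have t0 : 0 <= t%:R :> R by [].
rewrite coef_succ; apply: mulr_ile1 => //; first exact: coef_ge0.
by rewrite ler_pdivrMr; lra.
Qed.

Lemma sum_coef (R : realType) (t : nat) :
  \sum_(0 <= s < t) coef R s = 2 * t%:R * coef R t.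
Proof.
elim: t => [|t IH]; first by rewrite big_geq // mulr0 mul0r.
rewrite big_nat_recr //= IH -[t.+1%:R]natr1 mulrDr mulr1 coefS_eq.
by ring.
Qed.

(** t c_t^2 is nondecreasing in t; this is the source of c_t / c_M <= sqrt (M / t). *)
Lemma coef_ratio (R : realType) (t M : nat) : (t <= M)%N ->
  t%:R * coef R t ^+ 2 <= M%:R * coef R M ^+ 2.
Proof.
pose f t : R := t%:R * coef R t ^+ 2; suff /nondecreasing_seqP fS :
  forall t, f t <= f t.+1 by exact: fS.
rewrite {}/f => {}t; have t0 : 0 <= t%:R :> R by [].
have E := coefS_eq R t; have c0 := coef_gt0 R t.
have sq := congr1 (fun x => x ^+ 2) E.
have lt2 : 0 < (2 * t%:R + 2) ^+ 2 :> R by rewrite exprn_gt0 //; lra.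
rewrite -(ler_pM2l lt2) -[t.+1%:R]natr1.
have -> : (2 * t%:R + 2) ^+ 2 * ((t%:R + 1) * coef R t.+1 ^+ 2) =
  (t%:R + 1) * ((2 * t%:R + 2) * coef R t.+1) ^+ 2 by ring.
rewrite E -subr_ge0.
have -> : (t%:R + 1) * ((2 * t%:R + 1) * coef R t) ^+ 2
   - (2 * t%:R + 2) ^+ 2 * (t%:R * coef R t ^+ 2)
   = (t%:R + 1) * coef R t ^+ 2 by ring.
by rewrite mulr_ge0 ?sqr_ge0 //; lra.
Qed.

(** * The cut as a deterministic main term plus weighted increments *)

Section Cut.
Variables (R : realType) (a : nat -> R).

(** The total degree of A in T_t: the edge of step i has the ends i and [w i], which contribute
    [a i] and [x i]. *)
Definition volume (x : nat -> R) (t : nat) : R := \sum_(0 <= i < t) (a i + x i).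

(** The conditional probability that mini-vertex t attaches to A; the extra [a t] is the possible
    loop. *)
Definition attach (x : nat -> R) (t : nat) : R :=
  (volume x t + a t) / (2 * t%:R + 1).

(* Up to a deterministic term, the cut edges still to come have conditional
   expectation [rho M t] times the volume at time [t]. *)
Definition rho (M t : nat) : R :=
  coef R t * \sum_(t <= u < M) (1 - 2 * a u) / (coef R u * (2 * u%:R + 1)).

(** The effect of [x t] on the cut: [1 - 2 * a t] through the edge of step t itself, [rho M t.+1]
    through the unit of volume it adds for later steps. *)
Definition gain (M t : nat) : R := 1 - 2 * a t + rho M t.+1.

(** One step multiplies a unit of volume by (2t+2)/(2t+1) on average and changes the expected cut by
    (1 - 2 a_t)/(2t+1). *)
Lemma rhoS (M t : nat) : (t < M)%N ->
  (2 * t%:R + 1) * rho M t = (2 * t%:R + 2) * rho M t.+1 + (1 - 2 * a t).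
Proof.
move=> tM; rewrite /rho big_ltn //; set S := \sum_(_ <= _ < _) _.
have t0 : 0 <= t%:R :> R by []; have c0 := coef_gt0 R t.
rewrite (mulrA (2 * t%:R + 2)) coefS_eq; field.
by rewrite gt_eqF //=; lra.
Qed.

Lemma cut_decomposition (M : nat) (x : nat -> R) :
  \sum_(0 <= t < M) (a t + (1 - 2 * a t) * x t) =
  \sum_(0 <= t < M) a t * (1 + rho M t)
  + \sum_(0 <= t < M) gain M t * (x t - attach x t).
Proof.
(* The potential [rho M k * volume x k] makes the identity hold at every time; it vanishes at k = 0
   (no volume) and at k = M (empty sum in [rho]). *)
suff H k : (k <= M)%N ->
    \sum_(0 <= t < k) (a t + (1 - 2 * a t) * x t) + rho M k * volume x k =
    \sum_(0 <= t < k) a t * (1 + rho M t)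
    + \sum_(0 <= t < k) gain M t * (x t - attach x t).
  by rewrite -H // /rho (@big_geq _ _ _ M M) // mulr0 mul0r addr0.
elim: k => [_|k IH kM]; first by rewrite /volume !big_geq // mulr0 !addr0.
have {IH} := IH (ltnW kM); rewrite /attach /gain /volume !big_nat_recr //=.
rewrite -/(volume x k); set S1 := \sum_(0 <= t < k) (_ + _).
set S2 := \sum_(0 <= t < k) _ * _; set S3 := \sum_(0 <= t < k) _ * _.
have := rhoS kM; move: (rho M k) (rho M k.+1) (volume x k) => r r' V rE IH.
have k0 : (2 * k%:R + 1 : R) != 0 by rewrite gt_eqF // ltr_pwDr // mulr_ge0.
have -> : S1 = S2 + S3 - r * V by rewrite -IH; ring.
have -> : r = ((2 * k%:R + 2) * r' + (1 - 2 * a k)) / (2 * k%:R + 1).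
  by rewrite -rE; field.
by field.
Qed.


Definition weight (t : nat) : R := \sum_(0 <= s < t) a s * coef R s.

(** The solution of [x t = attach x t] in closed form; its volume at time t is
    [weight t / coef R t]. *)
Definition mean_step (t : nat) : R := weight t.+1 / (coef R t * (2 * t%:R + 1)).

Lemma weightS (t : nat) : weight t.+1 = weight t + a t * coef R t.
Proof. by rewrite /weight big_nat_recr. Qed.

Lemma volume_mean_step (t : nat) : volume mean_step t = weight t / coef R t.
Proof.
elim: t => [|t IH]; first by rewrite /volume /weight !big_geq // mul0r.
rewrite /volume big_nat_recr //= -/(volume _ t) IH /mean_step weightS coef_succ.
have c0 := coef_gt0 R t; have t0 : 0 <= t%:R :> R by [].
by field; rewrite !gt_eqF //; lra.
Qed.

Lemma attach_mean_step (t : nat) : attach mean_step t = mean_step t.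
Proof.
rewrite /attach volume_mean_step /mean_step weightS.
have c0 := coef_gt0 R t; have t0 : 0 <= t%:R :> R by [].
by field; rewrite !gt_eqF //; lra.
Qed.

(* The attachments [mean_step] are those for which every martingale increment
   [x t - attach x t] vanishes. *)
Lemma sum_rhoE (M : nat) : \sum_(0 <= t < M) a t * (1 + rho M t) =
  weight M / coef R M - 2 * \sum_(0 <= t < M) a t * mean_step t.
Proof.
have := cut_decomposition M mean_step.
rewrite [X in _ + X]big1 ?addr0 => [<-|t _]; last first.
  by rewrite attach_mean_step subrr mulr0.
rewrite -volume_mean_step /volume mulr_sumr -sumrB.
by apply: eq_bigr => t _; ring.
Qed.

Hypothesis a01 : forall t, 0 <= a t <= 1.

Lemma weight_ge0 (t : nat) : 0 <= weight t.
Proof.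
apply: sumr_ge0 => i _; apply: mulr_ge0; last exact: coef_ge0.
by case/andP: (a01 i).
Qed.

Lemma weight_le (t : nat) : weight t <= 2 * t%:R * coef R t.
Proof.
rewrite -sum_coef; apply: ler_sum => i _; rewrite ler_piMl //.
  exact: coef_ge0.
by case/andP: (a01 i).
Qed.

(** By Wallis 1 / (c_t (2t+1)) is close to (pi / 2) c_t, so [a t * mean_step t] is close to (pi / 2)
    a_t c_t [weight t.+1], which is pi / 4 times the increment of [weight ^+ 2] up to a term of
    order c_t^2. *)
Lemma mean_inner_step (t : nat) :
  - (pi / 2) * coef R t ^+ 2 <= a t * mean_step t
    - pi / 4 * (weight t.+1 ^+ 2 - weight t ^+ 2) <= pi / 4 * coef R t ^+ 2.
Proof.
have c0 := coef_gt0 R t; have t0 : 0 <= t%:R :> R by [].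
have /andP[a0 a1] := a01 t; have B0 := weight_ge0 t.+1.
have Bub : weight t.+1 <= (2 * t%:R + 1) * coef R t.
  by rewrite -coefS_eq (le_trans (weight_le _)) // -[t.+1%:R]natr1; lra.
have lb := coef_sqr_lb R t; have ub := coef_sqr_ub R t.
have piP := pi_gt0 R.
have -> : weight t = weight t.+1 - a t * coef R t by rewrite weightS addrK.
rewrite /mean_step; set B := weight t.+1 in B0 Bub *.
set c := coef R t in c0 Bub lb ub *; set i := (c * (2 * t%:R + 1))^-1.
have i_ub : i <= pi / 2 * c.
  by rewrite /i -div1r ler_pdivrMr ?mulr_gt0 //; lra.
have i_lb : pi / 2 * c - pi / 2 * c * (2 * t%:R + 1)^-1 <= i.
  have -> : pi / 2 * c - pi / 2 * c * (2 * t%:R + 1)^-1 =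
     pi * t%:R * c ^+ 2 * i.
    by rewrite /i; field; rewrite !gt_eqF //; lra.
  by rewrite ler_piMl // invr_ge0 mulr_ge0 ?ltW //; lra.
have aB0 : 0 <= a t * B by rewrite mulr_ge0.
have aBub : a t * B <= (2 * t%:R + 1) * c.
  by rewrite (le_trans _ Bub) // ler_piMl.
have h1 : a t * B * i <= a t * B * (pi / 2 * c) by rewrite ler_wpM2l.
have h2 : a t * B * (pi / 2 * c - pi / 2 * c * (2 * t%:R + 1)^-1) <= a t * B * i.
  by rewrite ler_wpM2l.
(* The relative error 1 / (2t+1) is absorbed by the factor 2t + 1 in the bound on [B]. *)
have h3 : a t * B * (pi / 2 * c * (2 * t%:R + 1)^-1) <= pi / 2 * c ^+ 2.
  have -> : pi / 2 * c ^+ 2 =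
     (2 * t%:R + 1) * c * (pi / 2 * c * (2 * t%:R + 1)^-1) by field; lra.
  by rewrite ler_wpM2r // !mulr_ge0 ?invr_ge0 ?ltW //; lra.
have h4 : 0 <= pi / 4 * (a t * c) ^+ 2 by rewrite mulr_ge0 ?sqr_ge0 ?divr_ge0 ?ltW.
have h5 : pi / 4 * (a t * c) ^+ 2 <= pi / 4 * c ^+ 2.
  rewrite ler_pM2l ?divr_gt0 // exprMn.
  by rewrite ler_piMl ?sqr_ge0 // expr_le1.
by apply/andP; split; lra.
Qed.

Lemma mean_inner (M : nat) :
  - (pi * M%:R * coef R M) <= \sum_(0 <= t < M) a t * mean_step t
    - pi / 4 * weight M ^+ 2 <= pi / 2 * M%:R * coef R M.
Proof.
have tele : pi / 4 * weight M ^+ 2 =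
    \sum_(0 <= t < M) pi / 4 * (weight t.+1 ^+ 2 - weight t ^+ 2).
  rewrite -mulr_sumr telescope_sumr // [weight 0]/weight big_geq //.
  by rewrite expr0n subr0.
(* The errors c_t^2 are relaxed to c_t, whose sum 2 M c_M is explicit and still O(sqrt M). *)
have c2 t : coef R t ^+ 2 <= coef R t.
  by rewrite expr2 ler_piMl ?coef_le1 ?coef_ge0.
have pi0 := pi_ge0 R.
rewrite tele -sumrB; apply/andP; split.
  have -> : - (pi * M%:R * coef R M) =
     \sum_(0 <= t < M) - (pi / 2) * coef R t.
    by rewrite -mulr_sumr sum_coef; field.
  apply: ler_sum => t _; have /andP[+ _] := mean_inner_step t.
  by apply: le_trans; rewrite !mulNr lerN2 ler_wpM2l ?divr_ge0.
have -> : pi / 2 * M%:R * coef R M = \sum_(0 <= t < M) (pi / 4) * coef R t.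
  by rewrite -mulr_sumr sum_coef; field.
apply: ler_sum => t _; have /andP[_] := mean_inner_step t.
by move=> /le_trans; apply; rewrite ler_wpM2l ?divr_ge0.
Qed.

(** Replacing 1 / c_M by r = sqrt (pi M) in [sum_rhoE] costs at most 1, and [mean_inner] costs at
    most 2 r; what remains is exactly r [weight M] - 2 m^2. *)
Lemma mean_cut (M : nat) (m : R) : m = Num.sqrt pi / 2 * weight M ->
  `|\sum_(0 <= t < M) a t * (1 + rho M t) - 2 * m * (Num.sqrt M%:R - m)|
  <= 1 + 2 * Num.sqrt (pi * M%:R).
Proof.
move=> mE; have c0 := coef_gt0 R M; have M0 : 0 <= M%:R :> R by [].
have pi0 := pi_ge0 R.
have lb := coef_sqr_lb R M; have ub := coef_sqr_ub R M.
have B0 := weight_ge0 M; have Bub := weight_le M.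
have /andP[] := mean_inner M; rewrite sum_rhoE.
set S := \sum_(0 <= t < M) _; set B := weight M in mE B0 Bub *.
set c := coef R M in c0 lb ub Bub *.
pose r : R := Num.sqrt (pi * M%:R); have r0 : 0 <= r := sqrtr_ge0 _.
have r2 : r ^+ 2 = pi * M%:R by rewrite sqr_sqrtr ?mulr_ge0.
have rc0 : 0 <= r * c by rewrite mulr_ge0 // ltW.
have z1 : r * c <= 1.
  by rewrite -(@expr_le1 _ 2) // exprMn r2.
have m2 : m ^+ 2 = pi / 4 * B ^+ 2.
  by rewrite mE !exprMn sqr_sqrtr // exprVn; field.
have mM : 2 * m * Num.sqrt M%:R = r * B by rewrite mE /r sqrtrM //; field.
have -> : 2 * m * (Num.sqrt M%:R - m) = r * B - 2 * (pi / 4 * B ^+ 2).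
  by rewrite mulrBr mM -m2; ring.
have rr : pi * M%:R * c <= r.
  by rewrite -r2 expr2 -mulrA ler_piMr.
have d0 : 0 <= B / c - r * B.
  by rewrite subr_ge0 ler_pdivlMr // mulrAC ler_piMl.
(* Since B / c <= 2 M, it suffices that 2 M (1 - r c) <= 1; this follows from [lb] and r c <= 1. *)
have d1 : B / c - r * B <= 1.
  have -> : B / c - r * B = B / c * (1 - r * c) by field; rewrite gt_eqF.
  have : B / c * (1 - r * c) <= 2 * M%:R * (1 - r * c).
    by rewrite ler_wpM2r ?subr_ge0 // ler_pdivrMr.
  move/le_trans; apply.
  have zz : (r * c) ^+ 2 <= r * c by rewrite expr2 ler_piMl.
  have zM : M%:R <= (M%:R + 2^-1) * (r * c) ^+ 2.
    have -> : (M%:R + 2^-1) * (r * c) ^+ 2 = M%:R * (pi * (M%:R + 2^-1) * c ^+ 2).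
      by rewrite exprMn r2; ring.
    by rewrite ler_peMr.
  have : M%:R * (r * c) ^+ 2 <= M%:R * (r * c) by rewrite ler_wpM2l.
  move: zM zz z1; rewrite mulrDl; move: (r * c) => z; lra.
rewrite -/r ler_norml => s1 s2; apply/andP; split; lra.
Qed.

(** With |1 - 2 a_u| <= 1 the sum in [rho] telescopes: 1 / (c_u (2u+1)) = 1 / c_(u+1) - 1 / c_u. *)
Lemma rho_le (M t : nat) : (t <= M)%N -> `|rho M t| <= coef R t / coef R M - 1.
Proof.
move=> tM; have ct := coef_gt0 R t.
rewrite normrM gtr0_norm //.
have -> : coef R t / coef R M - 1 =
    coef R t * \sum_(t <= u < M) ((coef R u.+1)^-1 - (coef R u)^-1).
  by rewrite telescope_sumr // mulrBr divff ?gt_eqF.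
rewrite ler_pM2l //; apply: (le_trans (ler_norm_sum _ _ _)).
apply: ler_sum => u _; have cu := coef_gt0 R u; have u0 : 0 <= u%:R :> R by [].
have -> : (coef R u.+1)^-1 - (coef R u)^-1 = (coef R u * (2 * u%:R + 1))^-1.
  by rewrite coef_succ; field; rewrite !gt_eqF //; lra.
rewrite normrM [`|(_ * _)^-1|]gtr0_norm ?invr_gt0 ?mulr_gt0 //.
rewrite ler_piMl //; first by rewrite ltW // invr_gt0 mulr_gt0.
by have := a01 u; rewrite ler_norml; lra.
Qed.

Lemma gain_le (M t : nat) : (t < M)%N -> `|gain M t| <= coef R t.+1 / coef R M.
Proof.
move=> tM; apply: (le_trans (ler_normD _ _)).
have := rho_le tM; have : `|1 - 2 * a t| <= 1.
  by have := a01 t; rewrite ler_norml; lra.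
by lra.
Qed.
End Cut.

(** The bounds c_t / c_M sum to 2 n c_n / c_M, and [coef_ratio] gives n c_n / c_M <= sqrt (n M). *)
Lemma gain_head (R : realType) (a : nat -> R) (n M : nat) :
  (forall t, 0 <= a t <= 1) -> (n <= M)%N ->
  \sum_(0 <= t < n) `|gain a M t| <= 2 * Num.sqrt (n * M)%:R.
Proof.
move=> a01 nM; have cM := coef_gt0 R M.
have coef_dec t : coef R t.+1 <= coef R t.
  rewrite coef_succ ler_piMr ?coef_ge0 // ler_pdivrMr ?ltr_pwDr ?mulr_ge0 //.
  by rewrite mul1r lerD2l; lra.
have : \sum_(0 <= t < n) `|gain a M t| <= \sum_(0 <= t < n) coef R t / coef R M.
  apply: ler_sum_nat => t /andP[_ tn].
  apply: le_trans (gain_le a01 (leq_trans tn nM)) _.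
  by rewrite ler_pM2r ?invr_gt0.
move=> /le_trans; apply; rewrite -mulr_suml sum_coef -!mulrA ler_pM2l //.
have n0 : 0 <= n%:R * (coef R n / coef R M).
  by rewrite mulr_ge0 // divr_ge0 ?coef_ge0.
rewrite -(ger0_norm n0) -sqrtr_sqr ler_wsqrtr // natrM.
have -> : (n%:R * (coef R n / coef R M)) ^+ 2 =
    n%:R * (n%:R * coef R n ^+ 2 / coef R M ^+ 2) by field; rewrite gt_eqF.
rewrite ler_wpM2l // ler_pdivrMr ?exprn_gt0 //.
exact: coef_ratio.
Qed.

(** Each squared gain is at most M / (t+1), and 1 / (t+1) <= ln (t+1) - ln t, which telescopes. *)
Lemma gain_tail (R : realType) (a : nat -> R) (n M : nat) :
  (forall t, 0 <= a t <= 1) -> (0 < n)%N -> (n <= M)%N ->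
  \sum_(n <= t < M) gain a M t ^+ 2 <= M%:R * (ln M%:R - ln n%:R).
Proof.
move=> a01 n0 nM; have cM := coef_gt0 R M.
rewrite -(telescope_sumr (fun t => ln t%:R) nM) mulr_sumr; apply: ler_sum_nat => t /andP[nt tM].
have t0 : 0 < t%:R :> R by rewrite ltr0n (leq_trans n0).
have le1 : gain a M t ^+ 2 <= M%:R * t.+1%:R^-1.
  have : gain a M t ^+ 2 <= (coef R t.+1 / coef R M) ^+ 2.
    rewrite -[X in X <= _]real_normK ?num_real // ler_pXn2r ?nnegrE //.
      exact: gain_le.
    by rewrite divr_ge0 ?coef_ge0.
  move=> /le_trans; apply.
  rewrite exprMn exprVn ler_pdivrMr ?exprn_gt0 // mulrAC ler_pdivlMr //.
  by rewrite mulrC; exact: coef_ratio.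
apply: (le_trans le1); rewrite ler_wpM2l //.
have := @le_ln1Dx R (- t.+1%:R^-1).
have -> : 1 + - t.+1%:R^-1 = t%:R / t.+1%:R :> R.
  by rewrite -[t.+1%:R]natr1; field; rewrite gt_eqF //; lra.
rewrite ln_div ?posrE // => le; have {le} := le _.
suff h : - 1 < - t.+1%:R^-1 :> R by move/(_ h); rewrite lerNr opprB.
by rewrite ltrN2 invf_lt1 // ltr1n ltnS (leq_trans n0).
Qed.

(** * Exponential moments and tail bounds for the attachment process *)

Definition update (M : nat) (w : choices M) (o s : 'I_M) : choices M :=
  [ffun i => if i == o then s else w i].

(** Choices are summed out from the last to the first: with the past fixed, the sum over choice t
    costs at most the deterministic [b t]. This plays the part of iterated conditional
    expectation. *)
Lemma chain_le (R : realType) (M : nat) (F : 'I_M -> choices M -> R)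
    (b : 'I_M -> R) :
  (forall t w, 0 <= F t w) ->
  (forall (t : 'I_M) (w w' : choices M), (forall k : 'I_M, (k <= t)%N -> w k = w' k) ->
     F t w = F t w') ->
  (forall (t : 'I_M) (w : choices M), (t < w t)%N -> F t w = 0) ->
  (forall (t : 'I_M) (w : choices M), (forall k : 'I_M, (w k <= k)%N) ->
     \sum_(s < M | (s <= t)%N) F t (update w t s) <= b t) ->
  \sum_(w : choices M) \prod_t F t w <= \prod_t b t.
Proof.
move=> F0 Floc Finv Fb.
pose agree k (v w : choices M) := [forall i : 'I_M, (i < k)%N ==> (w i == v i)].
(* The all-loops outcome is legal; it shows that [b] is nonnegative and starts the induction. *)
have idle : forall k : 'I_M, ([ffun i => i] : choices M) k = k.
  by move=> k; rewrite ffunE.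
have b0 t : 0 <= b t.
  apply: le_trans (Fb t [ffun i => i] _); first exact: sumr_ge0.
  by move=> k; rewrite idle.
(* j counts the choices still free; those before k are fixed to a legal [v]. *)
suff main j : forall k, (k + j = M)%N ->
    forall v : choices M, (forall i, (v i <= i)%N) ->
    \sum_(w | agree k v w) \prod_(t < M | (k <= t)%N) F t w
    <= \prod_(t < M | (k <= t)%N) b t.
  have ile (i : 'I_M) : (([ffun i => i] : choices M) i <= i)%N by rewrite idle.
  have all0 : agree 0%N [ffun i => i] =1 xpredT by move=> w; apply/forallP.
  by have := main M 0%N (add0n M) _ ile; rewrite (eq_bigl _ _ all0).
elim: j => [|j IH] k kj v vle.
  have no (t : 'I_M) : (k <= t)%N = false.
    by apply/negbTE; rewrite -ltnNge -[k]addn0 kj.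
  rewrite [leRHS]big_pred0 // (big_pred1 v) => [|w]; first by rewrite big_pred0.
  apply/forallP/eqP => [vw|-> i]; last by rewrite eqxx implybT.
  by apply/ffunP => i; apply/eqP/(implyP (vw i)); rewrite -[k]addn0 kj.
have kM : (k < M)%N by rewrite -kj addnS ltnS leq_addr.
pose o := Ordinal kM.
have split (f : 'I_M -> R) : \prod_(t < M | (k <= t)%N) f t =
    f o * \prod_(t < M | (k.+1 <= t)%N) f t.
  rewrite (bigD1 o) //=; congr (_ * _); apply: eq_bigl => t.
  by rewrite [RHS]ltn_neqAle andbC -(inj_eq val_inj) [val o == _]eq_sym.
rewrite split (partition_big (fun w : choices M => w o) predT) //=.
rewrite (bigID (fun s : 'I_M => (s <= o)%N)) /= [X in _ + X]big1 ?addr0; last first.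
  move=> s; rewrite -ltnNge => os; apply: big1 => w /andP[_ /eqP wo].
  by rewrite split Finv ?wo // mul0r.
apply: (@le_trans _ _ (\sum_(s < M | (s <= o)%N)
    F o (update v o s) * \prod_(t < M | (k.+1 <= t)%N) b t)); last first.
  rewrite -mulr_suml; apply: ler_wpM2r; last exact: Fb.
  by apply: prodr_ge0 => t _; exact: b0.
apply: ler_sum => s so.
have ule i : (update v o s i <= i)%N.
  by rewrite ffunE; case: eqP => [->|_].
have kj' : (k.+1 + j = M)%N by rewrite addSnnS.
apply: (le_trans _ (ler_wpM2l (F0 o (update v o s)) (IH _ kj' _ ule))).
rewrite mulr_sumr le_eqVlt; apply/orP; left; apply/eqP.
have agS w : (agree k v w && (w o == s)) = agree k.+1 (update v o s) w.
  apply/andP/forallP => [[/forallP vw /eqP wo] i|vw].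
    rewrite ffunE; have [->|io] := eqVneq i o; first by rewrite wo eqxx implybT.
    rewrite ltnS leq_eqVlt -[k in _ == k]/(val o) (inj_eq val_inj) (negPf io).
    exact: vw.
  split; last by have := vw o; rewrite ffunE eqxx ltnSn.
  apply/forallP => i; have := vw i; rewrite ffunE.
  have [->|io] := eqVneq i o; first by rewrite ltnn.
  by move=> iv; apply/implyP => ik; apply: (implyP iv); exact: ltnW.
rewrite (eq_bigl _ _ agS); apply: eq_bigr => w /forallP wu.
rewrite split; congr (_ * _); apply: Floc => i io.
by apply/eqP/(implyP (wu i)); rewrite ltnS.
Qed.

Lemma eq_pa_tree (M : nat) (w w' : choices M) (t : nat) :
  (forall k : 'I_M, (k < t)%N -> w k = w' k) -> pa_tree w t = pa_tree w' t.
Proof.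
move=> ww'; apply/eq_in_map => k; rewrite mem_filter => /andP[kt _].
by rewrite ww'.
Qed.

Lemma pa_weight_eq0 (R : realType) (M : nat) (w : choices M) (k : 'I_M) :
  (k < w k)%N -> pa_weight R w = 0.
Proof.
move=> kw; rewrite /pa_weight (bigD1 k) //= /attach_prob ltnNge (ltnW kw) /=.
by rewrite -(inj_eq val_inj) gtn_eqF // mul0r.
Qed.

Definition hit_prob (R : realType) (M : nat) (w : choices M) (A : {set 'I_M})
    (t : 'I_M) : R :=
  \sum_(s < M | (s <= t)%N && (s \in A)) attach_prob R (pa_tree w t) t s.

Lemma hit_prob01 (R : realType) (M : nat) (w : choices M) (A : {set 'I_M})
    (t : 'I_M) :
  (forall k, (w k <= k)%N) -> 0 <= hit_prob R w A t <= 1.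
Proof.
move=> wle; rewrite -(sum_attach_prob R t wle) /hit_prob.
rewrite sumr_ge0 => [|s _]; last exact: attach_prob_ge0.
rewrite [leRHS](bigID (mem A)) /= lerDl sumr_ge0 // => s _.
exact: attach_prob_ge0.
Qed.

Definition fluctuation (R : realType) (M : nat) (A : {set 'I_M})
    (g : 'I_M -> R) (w : choices M) : R :=
  \sum_t g t * ((w t \in A)%:R - hit_prob R w A t).

(** Azuma-Hoeffding: given the past, the increment at t is [g t] times a centred Bernoulli variable
    of parameter [hit_prob], so [hoeffding] bounds its factor in [chain_le]. *)
Lemma mgf_fluctuation (R : realType) (M : nat) (A : {set 'I_M})
    (g : 'I_M -> R) :
  \sum_w pa_weight R w * expR (fluctuation A g w)
  <= expR ((\sum_t g t ^+ 2) / 8).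
Proof.
rewrite mulr_suml expR_sum.
pose F (t : 'I_M) (w : choices M) := attach_prob R (pa_tree w t) t (w t)
  * expR (g t * ((w t \in A)%:R - hit_prob R w A t)).
rewrite (eq_bigr (fun w => \prod_t F t w)) => [|w _]; last first.
  by rewrite big_split /= /pa_weight /fluctuation expR_sum.
have tree_loc (t : 'I_M) (w w' : choices M) :
    (forall k : 'I_M, (k < t)%N -> w k = w' k) ->
    pa_tree w t = pa_tree w' t /\ hit_prob R w A t = hit_prob R w' A t.
  by move=> ww'; rewrite /hit_prob (eq_pa_tree ww').
apply: chain_le => [t w|t w w' ww'|t w tw|t w wle].
- by rewrite mulr_ge0 ?expR_ge0 ?attach_prob_ge0.
- have [tE hE] := tree_loc t w w' (fun k kt => ww' k (ltnW kt)).
  by rewrite /F tE hE ww'.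
- rewrite /F /attach_prob ltnNge (ltnW tw) /=.
  by rewrite -(inj_eq val_inj) gtn_eqF // mul0r.
(* Changing choice t leaves T_t, hence also [hit_prob] at t, unchanged. *)
have upd s (k : 'I_M) : (k < t)%N -> update w t s k = w k.
  by rewrite ffunE; case: eqP => [->|//]; rewrite ltnn.
set p := hit_prob R w A t.
rewrite (eq_bigr (fun s => attach_prob R (pa_tree w t) t s
    * expR (g t * ((s \in A)%:R - p)))) => [|s st]; last first.
  have [tE hE] := tree_loc t (update w t s) w (upd s).
  by rewrite /F tE hE ffunE eqxx.
rewrite (bigID (mem A)) /=.
rewrite (eq_bigr (fun s => attach_prob R (pa_tree w t) t s
    * expR (g t * (1 - p)))) => [|s /andP[_ ->] //].
rewrite [X in _ + X](eq_bigr (fun s => attach_prob R (pa_tree w t) t s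
    * expR (g t * (0 - p)))) => [|s /andP[_ /negbTE ->] //].
rewrite -!mulr_suml -/(hit_prob R w A t) -/p.
have -> : \sum_(s < M | (s <= t)%N && (s \notin A))
    attach_prob R (pa_tree w t) t s = 1 - p.
  by rewrite -(sum_attach_prob R t wle) [in RHS](bigID (mem A)) /= addrAC subrr add0r.
exact/hoeffding/hit_prob01.
Qed.

Lemma le_pa_prob (R : realType) (M : nat) (E : pred (choices M))
    (f : choices M -> R) :
  (forall w, 0 <= f w) -> (forall w, E w -> 1 <= f w) ->
  pa_prob R E <= \sum_w pa_weight R w * f w.
Proof.
move=> f0 f1; rewrite /pa_prob [leRHS](bigID E) /= -[leLHS]addr0.
apply: lerD; last first.
  by apply: sumr_ge0 => w _; rewrite mulr_ge0 ?pa_weight_ge0.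
by apply: ler_sum => w Ew; rewrite ler_peMr ?pa_weight_ge0 ?f1.
Qed.

Lemma tail_fluctuation (R : realType) (M : nat) (A : {set 'I_M})
    (g : 'I_M -> R) (V l : R) : 0 < V -> 0 <= l -> \sum_t g t ^+ 2 <= V ->
  pa_prob R (fun w => l < fluctuation A g w) <= expR (- (2 * l ^+ 2 / V)).
Proof.
(* Chernoff's method; this [s] minimises s^2 V / 8 - s l. *)
move=> V0 l0 gV; pose s := 4 * l / V.
have s0 : 0 <= s by rewrite divr_ge0 ?mulr_ge0 // ltW.
have sfE w : fluctuation A (fun t => s * g t) w = s * fluctuation A g w.
  by rewrite /fluctuation mulr_sumr; apply: eq_bigr => t _; rewrite mulrA.
apply: le_trans (le_pa_prob (f := fun w =>
    expR (fluctuation A (fun t => s * g t) w) * expR (- (s * l))) _ _) _.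
- by move=> w; rewrite mulr_ge0 ?expR_ge0.
- move=> w lw; rewrite -expRD sfE -mulrBr -expR0 ler_expR mulr_ge0 //.
  by rewrite subr_ge0 ltW.
rewrite (eq_bigr (fun w => pa_weight R w *
    expR (fluctuation A (fun t => s * g t) w) * expR (- (s * l)))); last first.
  by move=> w _; rewrite mulrA.
rewrite -mulr_suml.
apply: le_trans (ler_wpM2r (expR_ge0 _) (mgf_fluctuation _ _)) _.
rewrite -expRD ler_expR.
have -> : \sum_t (s * g t) ^+ 2 = s ^+ 2 * \sum_t g t ^+ 2.
  by rewrite mulr_sumr; apply: eq_bigr => t _; rewrite exprMn.
have : s ^+ 2 * \sum_t g t ^+ 2 <= s ^+ 2 * V by rewrite ler_wpM2l ?sqr_ge0.
have -> : - (2 * l ^+ 2 / V) = s ^+ 2 * V / 8 - s * l.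
  by rewrite /s; field; rewrite gt_eqF.
by lra.
Qed.

Lemma tail_norm_fluctuation (R : realType) (M : nat) (A : {set 'I_M})
    (g : 'I_M -> R) (V l : R) : 0 < V -> 0 <= l -> \sum_t g t ^+ 2 <= V ->
  pa_prob R (fun w => l < `|fluctuation A g w|)
  <= 2 * expR (- (2 * l ^+ 2 / V)).
Proof.
move=> V0 l0 gV; rewrite mulrDl mul1r.
have gV' : \sum_t (- g t) ^+ 2 <= V.
  by under eq_bigr do rewrite sqrrN.
have := lerD (tail_fluctuation A V0 l0 gV) (tail_fluctuation A V0 l0 gV').
apply: le_trans; rewrite /pa_prob big_mkcond.
rewrite [X in _ <= X + _]big_mkcond [X in _ <= _ + X]big_mkcond -big_split /=.
apply: ler_sum => w _.
have -> : fluctuation A (fun t => - g t) w = - fluctuation A g w.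
  by rewrite /fluctuation -sumrN; apply: eq_bigr => t _; rewrite mulNr.
have w0 := pa_weight_ge0 R w; rewrite lter_normr.
by case: (l < _); case: (l < _) => /=; rewrite ?addr0 ?add0r ?lerDl ?lerDr //.
Qed.

Lemma pa_prob_exists (R : realType) (M : nat) (I : finType)
    (E : I -> pred (choices M)) :
  pa_prob R (fun w => [exists i, E i w]) <= \sum_i pa_prob R (E i).
Proof.
rewrite /pa_prob; under [leRHS]eq_bigr do rewrite big_mkcond.
rewrite exchange_big big_mkcond /=; apply: ler_sum => w _.
have E0 i : 0 <= (if E i w then pa_weight R w else 0).
  by case: ifP => // _; exact: pa_weight_ge0.
case: ifPn => [/existsP[i Ei]|_]; last exact: sumr_ge0.
by rewrite (bigD1 i) //= Ei lerDl sumr_ge0.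
Qed.

(** * Passage from the random graph to real sequences *)

Definition extend (R : realType) (M : nat) (f : 'I_M -> R) (i : nat) : R :=
  oapp f 0 (insub i).

Lemma extendE (R : realType) (M : nat) (f : 'I_M -> R) (k : 'I_M) :
  extend f k = f k.
Proof. by rewrite /extend valK. Qed.

(** The default 0 beyond M keeps the values in [0, 1] at every natural index, as [a01] demands. *)
Definition indicator (R : realType) (M : nat) (P : pred 'I_M) : nat -> R :=
  extend (fun k => (P k)%:R).

Lemma indicator01 (R : realType) (M : nat) (P : pred 'I_M) (i : nat) :
  0 <= indicator R P i <= 1.
Proof.
by rewrite /indicator /extend; case: insub => [k|] /=; [case: (P k)|]; rewrite /= ?lexx ?ler01.
Qed.

Lemma big_nat_ord (R : realType) (M t : nat) (f : nat -> R) : (t <= M)%N ->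
  \sum_(0 <= i < t) f i = \sum_(k < M | (k < t)%N) f k.
Proof. by move=> tM; rewrite big_mkord (big_ord_widen M). Qed.

(** Double counting of the degrees in A before t, edge by edge; legality of [w] keeps both ends of
    these edges below t. *)
Lemma hit_probE (R : realType) (M : nat) (w : choices M) (A : {set 'I_M})
    (t : 'I_M) :
  (forall k, (w k <= k)%N) ->
  hit_prob R w A t =
  attach (indicator R (fun k => k \in A)) (indicator R (fun k => w k \in A)) t.
Proof.
move=> wle; have t1 : (2 * t + 1)%:R = 2 * t%:R + 1 :> R by rewrite natrD natrM.
rewrite /hit_prob /attach /volume (big_nat_ord _ (ltnW (ltn_ord t))).
rewrite big_mkcondr /= (bigD1 t) //= addrC mulrDl; congr (_ + _); last first.
  rewrite /indicator extendE /attach_prob ltnn eqxx t1 /=.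
  by case: ifP => _; rewrite ?mul0r.
transitivity (\sum_(s < M | (s < t)%N && (s \in A))
    (deg (pa_tree w t) s)%:R / (2 * t%:R + 1) : R).
  rewrite [RHS]big_mkcondr /=; apply: eq_big => s.
    by rewrite [RHS]ltn_neqAle andbC -(inj_eq val_inj).
  rewrite andbC -(inj_eq val_inj) -ltn_neqAle => st.
  by rewrite /attach_prob st t1.
rewrite -mulr_suml; congr (_ / _).
rewrite (eq_bigr (fun s => \sum_(k < M | (k < t)%N)
    ((k == s) + (w k == s))%N%:R)) => [|s _]; last by rewrite degE natr_sum.
rewrite exchange_big /=; apply: eq_bigr => k kt.
have pick (i : 'I_M) : (i < t)%N ->
    \sum_(s < M | (s < t)%N && (s \in A)) (i == s)%:R = (i \in A)%:R :> R.
  move=> it; rewrite big_mkcondr /= (bigD1 i) //= eqxx big1 ?addr0.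
    by case: (i \in A).
  by move=> s /andP[_ /negbTE si]; rewrite eq_sym si; case: ifP.
rewrite /indicator !extendE -(pick k kt) -(pick (w k)) ?(leq_ltn_trans (wle k)) //.
by rewrite -big_split /=; apply: eq_bigr => s _; rewrite natrD.
Qed.

(** For bits, a + (1 - 2 a) x is the exclusive or: an edge counts when exactly one end lies in S. *)
Lemma cutE (R : realType) (h n : nat) (w : choices (h * n)) (S : {set 'I_n}) :
  let a := indicator R (fun k => k \in mini h S) in
  let x := indicator R (fun k => w k \in mini h S) in
  (edges_between (pa_graph w) S (~: S)%SET)%:R =
  \sum_(0 <= t < h * n) (a t + (1 - 2 * a t) * x t).
Proof.
move=> a x; rewrite (big_nat_ord _ (leqnn _)).
rewrite /edges_between /pa_graph /merge_graph /pa_tree !count_map -sum1_count.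
rewrite big_filter_cond big_enum_cond /= natr_sum big_mkcondr /=.
apply: eq_bigr => k _; rewrite /a /x /indicator !extendE /Defs.meets /mini /= !finset.inE.
by case: (_ \in S); case: (_ \in S) => /=; ring.
Qed.

(** Starting at n = M / h turns ln M - ln n into ln h; the bound M / (t+1) summed from 0 would be of
    order M ln M. *)
Definition tail_gain (R : realType) (M : nat) (A : {set 'I_M}) (n : nat)
    (t : 'I_M) : R :=
  if (n <= t)%N then gain (indicator R (fun k => k \in A)) M t else 0.

Lemma tail_gain_sqr (R : realType) (h n : nat) (A : {set 'I_(h * n)}) :
  (0 < h)%N -> (0 < n)%N ->
  \sum_t tail_gain R A n t ^+ 2 <= (h * n)%:R * ln h%:R.
Proof.
move=> h0 n0; have nM : (n <= h * n)%N by rewrite leq_pmull.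
have := gain_tail (indicator01 R (fun k => k \in A)) n0 nM.
have -> : ln (h * n)%:R - ln n%:R = ln h%:R :> R.
  by rewrite natrM lnM ?posrE ?ltr0n // addrK.
rewrite big_geq_mkord /= [X in X <= _ -> _]big_mkcond /=; apply: le_trans.
rewrite le_eqVlt; apply/orP; left.
apply/eqP/eq_bigr => t _; rewrite /tail_gain.
by case: ifP => // _; rewrite expr0n.
Qed.

Lemma cut_deviation (R : realType) (h n : nat) (w : choices (h * n))
    (S : {set 'I_n}) : (0 < h)%N -> (forall k, (w k <= k)%N) ->
  `| (edges_between (pa_graph w) S (~: S)%SET)%:R
     - 2 * mu R (mini h S) * (Num.sqrt (h * n)%:R - mu R (mini h S)) |
  <= 1 + 2 * Num.sqrt (pi * (h * n)%:R) + 2 * Num.sqrt (n * (h * n))%:R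
     + `|fluctuation (mini h S) (tail_gain R (mini h S) n) w|.
Proof.
move=> h0 wle; set M := (h * n)%N; set A := mini h S.
have nM : (n <= M)%N by rewrite leq_pmull.
pose a := indicator R (fun k => k \in A); pose x := indicator R (fun k => w k \in A).
have a01 : forall t, 0 <= a t <= 1 by exact: indicator01.
have yE (t : 'I_M) : x t - attach a x t = (w t \in A)%:R - hit_prob R w A t.
  by rewrite hit_probE // /x /indicator extendE.
have muE : mu R A = Num.sqrt pi / 2 * weight a M.
  rewrite /mu /weight (big_nat_ord _ (leqnn _)) big_mkcond /=.
  congr (_ * _); apply: eq_big => [k|k _]; first by rewrite ltn_ord.
  rewrite /a /indicator extendE /=.
  by case: ifP => _; rewrite ?mul1r ?mul0r.
rewrite cutE -/a -/x cut_decomposition.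
have := mean_cut a01 muE; have := gain_head a01 nM.
rewrite -/M [\sum_(0 <= t < M) gain _ _ _ * _](big_cat_nat _ nM) //=.
set E := \sum_(0 <= t < M) _; set H := \sum_(0 <= t < n) _ * _.
have -> : \sum_(n <= t < M) gain a M t * (x t - attach a x t) =
    fluctuation A (tail_gain R A n) w.
  rewrite big_geq_mkord /= big_mkcond /fluctuation; apply: eq_bigr => t _.
  by rewrite yE /tail_gain; case: ifP => // _; rewrite mul0r.
move: (fluctuation _ _ _) => Y; set s := 2 * mu R A * _.
(* Early increments are bounded outright: |x - p| <= 1 for a bit x and a probability p. *)
have : `|H| <= \sum_(0 <= t < n) `|gain a M t|.
  apply: le_trans (ler_norm_sum _ _ _) _; apply: ler_sum_nat => t /andP[_ tn].
  rewrite normrM ler_piMr // -[t]/(val (Ordinal (leq_trans tn nM))) yE.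
  have := hit_prob01 R A (Ordinal (leq_trans tn nM)) wle.
  by rewrite ler_norml; case: (_ \in _) => /=; lra.
have -> : E + (H + Y) - s = (E - s) + H + Y by ring.
have := ler_normD (E - s + H) Y; have := ler_normD (E - s) H.
lra.
Qed.

(** * Choice of the constants and union bound *)

(* The term [8 / 9 * ln 2] keeps this positive when [h = 1] and makes
   [deviation] below a multiple of the square root occurring in [gV]. *)
Definition variance_bound (R : realType) (h n : nat) : R :=
  (h * n)%:R * (ln h%:R + 8 / 9 * ln 2).

Definition deviation (R : realType) (h n : nat) : R :=
  1 / 4 * Num.sqrt (2 * ln 2 * (9 * ln h%:R + 8 * ln 2))
  * ((h * n)%:R / Num.sqrt h%:R).

Lemma ln2_gt0 (R : realType) : 0 < ln 2 :> R.
Proof. by rewrite ln_gt0 // ltr1n. Qed.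

Lemma variance_bound_gt0 (R : realType) (h n : nat) :
  (0 < h)%N -> (0 < n)%N -> 0 < variance_bound R h n.
Proof.
move=> h0 n0; rewrite mulr_gt0 ?ltr0n ?muln_gt0 ?h0 //.
have l2 := ln2_gt0 R; have : 0 <= ln h%:R :> R by rewrite ln_ge0 ?ler1n.
by lra.
Qed.

Lemma deviation_ge0 (R : realType) (h n : nat) : 0 <= deviation R h n.
Proof. by rewrite /deviation !mulr_ge0 ?invr_ge0 ?sqrtr_ge0. Qed.

(** The 1/4 in [deviation] is 3/2 times the 1/6 of [gV]. The logarithm of h cancels and leaves the
    rate 9/4 > 1, enough against 2^n sets. *)
Lemma deviation_exponent (R : realType) (h n : nat) :
  (0 < h)%N -> (0 < n)%N ->
  2 * deviation R h n ^+ 2 / variance_bound R h n = 9 / 4 * n%:R * ln 2.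
Proof.
move=> h0 n0; have l2 := ln2_gt0 R.
have lh : 0 <= ln h%:R :> R by rewrite ln_ge0 ?ler1n.
have hR : 0 < h%:R :> R by rewrite ltr0n.
have nR : 0 < n%:R :> R by rewrite ltr0n.
rewrite /deviation /variance_bound !exprMn !exprVn !sqr_sqrtr ?ler0n //; last first.
  by rewrite !mulr_ge0 ?ltW //; lra.
by rewrite natrM; field; rewrite !gt_eqF //=; lra.
Qed.

Lemma exp_union_bound (R : realType) (n : nat) :
  (2 ^ n)%:R * (2 * expR (- (9 / 4 * n%:R * ln 2))) <= 2 * (1 / 2 : R) ^+ n.
Proof.
(* Rounding 9/4 down to 2 gives 4^-n, and 2^n 4^-n = 2^-n. *)
have le : expR (- (9 / 4 * n%:R * ln 2)) <= (1 / 4 : R) ^+ n.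
  have -> : (1 / 4 : R) ^+ n = expR (- (2 * n%:R * ln 2)).
    have -> : - (2 * n%:R * ln 2) = n%:R * - (ln 2 *+ 2) :> R.
      by rewrite -mulr_natr; ring.
    rewrite expRM_natl -lnXn // expRN lnK ?posrE ?exprn_gt0 //.
    by congr (_ ^+ _); field.
  have l2 := ln2_gt0 R; rewrite ler_expR lerN2 ler_pM2r // ler_wpM2r //; lra.
have := ler_wpM2l (ler0n R (2 ^ n)) le.
have -> : (2 ^ n)%:R * (1 / 4 : R) ^+ n = (1 / 2) ^+ n.
  by rewrite natrX -exprMn; congr (_ ^+ _); field.
by lra.
Qed.

(** In units of X = M / sqrt h, the early steps cost 2, the main-term error at most 1, and
    [deviation] a quarter of the root in [gV]; the summand 2 of [gV], times 3/2, pays for the 3. *)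
Lemma bound_slack (R : realType) (h n : nat) (eps : R) :
  (0 < h)%N -> (25 <= n)%N -> 0 < eps ->
  1 + 2 * Num.sqrt (pi * (h * n)%:R) + 2 * Num.sqrt (n * (h * n))%:R
  + deviation R h n
  <= (1 + eps) * (3 / 2 * gV R h + Num.sqrt (2 * ln 2))
     * ((h * n)%:R / Num.sqrt h%:R).
Proof.
move=> h0 n25 e0; have l2 := ln2_gt0 R.
have hR : 1 <= h%:R :> R by rewrite ler1n.
pose sh : R := Num.sqrt h%:R; have sh1 : 1 <= sh by rewrite -sqrtr1 ler_wsqrtr.
pose sn : R := Num.sqrt n%:R.
have sn2 : sn ^+ 2 = n%:R by rewrite sqr_sqrtr.
have sh2 : sh ^+ 2 = h%:R by rewrite sqr_sqrtr.
have sn5 : 5 <= sn.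
  have -> : 5 = Num.sqrt (5 ^+ 2) :> R by rewrite sqrtr_sqr ger0_norm.
  by rewrite ler_wsqrtr // -natrX ler_nat.
set X := (h * n)%:R / _; have XE : X = sh * sn ^+ 2.
  by rewrite /X natrM -sn2 -/sh -sh2; field; rewrite gt_eqF //; lra.
have -> : Num.sqrt (n * (h * n))%:R = X.
  rewrite XE; have -> : (n * (h * n))%:R = (sh * sn ^+ 2) ^+ 2 :> R.
    by rewrite exprMn sh2 sn2 !natrM; ring.
  by rewrite sqrtr_sqr ger0_norm // mulr_ge0 ?sqr_ge0 ?sqrtr_ge0.
have spi : Num.sqrt pi <= 2 :> R.
  have -> : 2 = Num.sqrt (2 ^+ 2) :> R by rewrite sqrtr_sqr ger0_norm.
  by rewrite ler_wsqrtr //; have := pihalf_lt2 R; lra.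
(* As sqrt pi <= 2, it suffices that n >= 4 sqrt n + 1, which holds from n = 25 on. *)
have piX : 1 + 2 * Num.sqrt (pi * (h * n)%:R) <= X.
  rewrite natrM sqrtrM ?pi_ge0 // sqrtrM // -/sh -/sn XE.
  have : sh * sn * Num.sqrt pi <= sh * sn * 2.
    by rewrite ler_wpM2l // mulr_ge0 ?sqrtr_ge0.
  have : 0 <= sh * (sn ^+ 2 - 4 * sn - 1) by apply: mulr_ge0; nra.
  by lra.
have X0 : 0 <= X by rewrite XE mulr_ge0 ?sqr_ge0 ?sqrtr_ge0.
pose G : R := Num.sqrt (2 * ln 2 * (9 * ln h%:R + 8 * ln 2)).
have G0 : 0 <= G by exact: sqrtr_ge0.
have s0 : 0 <= Num.sqrt (2 * ln 2) :> R by exact: sqrtr_ge0.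
have dE : deviation R h n = 1 / 4 * G * X by [].
have C : 3 + 1 / 4 * G <= 3 / 2 * gV R h + Num.sqrt (2 * ln 2).
  by rewrite /gV -/G; lra.
have : (3 + 1 / 4 * G) * X <=
   (1 + eps) * (3 / 2 * gV R h + Num.sqrt (2 * ln 2)) * X.
  rewrite ler_wpM2r // (le_trans C) // ler_peMl //; last lra.
  by apply: le_trans C; lra.
by rewrite dE; lra.
Qed.

Lemma cut_prob_ge (R : realType) (h n : nat) (eps : R) :
  (0 < h)%N -> (25 <= n)%N -> 0 < eps ->
  1 - 2 * (1 / 2) ^+ n <=
  pa_prob R (fun w : choices (h * n) =>
    [forall S : {set 'I_n},
       `| (edges_between (pa_graph w) S (~: S)%SET)%:R
          - 2 * mu R (mini h S)
            * (Num.sqrt (h * n)%:R - mu R (mini h S)) |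
       <= (1 + eps) * (3 / 2 * gV R h + Num.sqrt (2 * ln 2))
          * ((h * n)%:R / Num.sqrt h%:R) ]).
Proof.
move=> h0 n25 e0; have n0 : (0 < n)%N by exact: leq_trans n25.
set E := fun w : choices (h * n) => _.
pose Y (S : {set 'I_n}) := fluctuation (mini h S) (tail_gain R (mini h S) n).
pose B S := [pred w | deviation R h n < `|Y S w|].
have : pa_prob R (fun w => [exists S, B S w]) <= 2 * (1 / 2) ^+ n.
  apply: le_trans (pa_prob_exists _ _) _; apply: le_trans (exp_union_bound R n).
  rewrite -(deviation_exponent R h0 n0).
  apply: (@le_trans _ _ (\sum_(S : {set 'I_n}) 2 * expR
      (- (2 * deviation R h n ^+ 2 / variance_bound R h n)))).
    apply: ler_sum => S _; apply: tail_norm_fluctuation.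
    - exact: variance_bound_gt0.
    - exact: deviation_ge0.
    apply: le_trans (tail_gain_sqr _ _ h0 n0) _.
    by rewrite ler_wpM2l // lerDl mulr_ge0 // ltW ?ln2_gt0.
  rewrite sumr_const -cardsT -powersetT card_powerset cardsT card_ord.
  by rewrite [leRHS]mulr_natl.
have : pa_prob R E + pa_prob R (fun w => ~~ E w) = 1.
  by rewrite -[RHS](pa_prob_total R (h * n)) /pa_prob [RHS](bigID E).
suff : pa_prob R (fun w => ~~ E w) <= pa_prob R (fun w => [exists S, B S w]) by lra.
rewrite /pa_prob [leLHS]big_mkcond [leRHS]big_mkcond; apply: ler_sum => w _.
have w0 := pa_weight_ge0 R w.
case: ifPn => [/forallPn[S nS]|_]; last by case: ifP.
(* Outcomes attaching some k to a later mini-vertex have weight 0, so only legal ones matter. *)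
case: (boolP [forall k, (w k <= k)%N]) => [/forallP wle|/forallPn[k]]; last first.
  by rewrite -ltnNge => /(pa_weight_eq0 R) ->; rewrite if_same.
have -> // : [exists S, B S w].
apply/existsP; exists S; rewrite /B /= ltNge; apply: contra nS => YS.
apply: le_trans (cut_deviation R S h0 wle) _.
apply: le_trans (bound_slack h0 n25 e0).
by rewrite lerD2l.
Qed.

Theorem theorem10 (R : realType) (h : nat) (h_gt0 : (0 < h)%N)
    (eps : R) (eps_gt0 : 0 < eps) :
  (fun n : nat =>
     pa_prob R (fun w : choices (h * n) =>
       [forall S : {set 'I_n},
          `| (edges_between (pa_graph w) S (~: S)%SET)%:R
             - 2 * mu R (mini h S)
               * (Num.sqrt (h * n)%:R - mu R (mini h S)) |
          <= (1 + eps) * (3 / 2 * gV R h + Num.sqrt (2 * ln 2))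
             * ((h * n)%:R / Num.sqrt h%:R) ]))
    @ \oo --> (1 : R).
Proof.
have low : 1 - 2 * (1 / 2 : R) ^+ n @[n --> \oo] --> (1 : R).
  rewrite -[X in _ --> X]subr0 -[X in _ --> _ - X](mulr0 2).
  apply: cvgB; first exact: cvg_cst.
  apply: cvgMr; apply: cvg_expr.
  by rewrite ger0_norm; lra.
apply: squeeze_cvgr low (cvg_cst (1 : R)).
near=> n; apply/andP; split.
  by apply: cut_prob_ge => //; near: n; exact: nbhs_infty_ge.
rewrite -[leRHS](pa_prob_total R (h * n)) /pa_prob big_mkcond.
apply: ler_sum => w _; case: ifP => // _; exact: pa_weight_ge0.
Unshelve. all: by end_near.
Qed.
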